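(* Let $\mathbb{K}\in\{\mathbb{R},\mathbb{C}\}$ and let $X$ and $Y$ be $\mathbb{K}$-operator spaces. If $X$ almost completely coarsely embeds into $Y$, then $X$ completely $\mathbb{R}$-isomorphically embeds into the ultrapower $Y^{\mathbb{N}}/\mathcal{U}$ for any nonprincipal ultrafilter $\mathcal{U}$ on $\mathbb{N}$.
   Context: A $\mathbb{K}$-operator space is a closed $\mathbb{K}$-linear subspace $X$ of $B(H)$ for a $\mathbb{K}$-Hilbert space $H$; $M_n(X)$ carries the norm $\|\cdot\|_n$ inherited from $M_n(B(H))=B(H^n)$ ($H^n$ the $\ell_2$-direct sum of $n$ copies of $H$). For a map $f:X\to Y$ between operator spaces and $[x_{ij}]\in M_n(X)$, $f([x_{ij}])$ denotes $[f(x_{ij})]\in M_n(Y)$ (the $n$-th amplification of $f$). $X$ almost completely coarsely embeds into $Y$ if there are functions $\omega,\rho:[0,\infty)\to[0,\infty)$ with $\lim_{t\to\infty}\rho(t)=\infty$ and a sequence of (not necessarily linear) maps $(f^n:X\to Y)_{n\in\mathbb{N}}$ (here $n$ is an index, not a power) such that $$\rho(\|[x_{ij}]-[y_{ij}]\|_n)\le\|f^n([x_{ij}])-f^n([y_{ij}])\|_n\le\omega(\|[x_{ij}]-[y_{ij}]\|_n)$$ for all $n\in\mathbb{N}$ and all $[x_{ij}],[y_{ij}]\in M_n(X)$. $X$ completely $\mathbb{R}$-isomorphically embeds into an operator space $Z$ if there is an injective $\mathbb{R}$-linear map $u:X\to Z$ such that both $u$ and $u^{-1}:u(X)\to X$ are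 completely bounded, i.e. the operator norms of all their entrywise amplifications are bounded uniformly in $n$. $Y^{\mathbb{N}}/\mathcal{U}$ is the operator space ultrapower: the quotient of the space of bounded sequences in $Y$ by the sequences $(y_m)_m$ with $\lim_{\mathcal{U}}\|y_m\|=0$, with matrix norms $\|[[(y^{ij}_m)_m]]_{ij}\|_n=\lim_{m\to\mathcal{U}}\|[y^{ij}_m]_{ij}\|_{M_n(Y)}$. *)

(* Defs.v *)
From HB Require Import structures.
From mathcomp Require Import all_boot all_order all_algebra.
From mathcomp Require Import sesquilinear complex.
From mathcomp Require Import all_classical all_reals all_analysis.

Set Implicit Arguments.
Unset Strict Implicit.
Unset Printing Implicit Defensive.

Import Order.TTheory GRing.Theory Num.Theory.
Import numFieldNormedType.Exports.

Local Open Scope classical_set_scope.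
Local Open Scope ring_scope.
Local Open Scope complex_scope.

Variant scalar_kind := RealScalars | ComplexScalars.

Definition scalar (R : realType) (k : scalar_kind) : numFieldType :=
  match k with RealScalars => R | ComplexScalars => R[i] end.

Definition scalar_conj (R : realType) (k : scalar_kind) :
    scalar R k -> scalar R k :=
  match k with RealScalars => idfun | ComplexScalars => @conjc R end.

Definition scalar_re (R : realType) (k : scalar_kind) : scalar R k -> R :=
  match k with RealScalars => idfun | ComplexScalars => @complex.Re R end.

Definition of_real (R : realType) (k : scalar_kind) : R -> scalar R k :=
  match k with RealScalars => idfun | ComplexScalars => @real_complex R end.

Arguments of_real {R} k _.

(* The inner product is linear in its first argument; positive definiteness
   and Hermitian symmetry are part of [{dot _ for _}], and completeness is
   part of [completeNormedModType]. *)
Record hilbert_space (R : realType) (k : scalar_kind) := HilbertSpace {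
  hilbert_sort :> completeNormedModType (scalar R k);
  hilbert_inner : {dot hilbert_sort for @scalar_conj R k};
  hilbert_normE : forall x : hilbert_sort, `|x| ^+ 2 = hilbert_inner x x
}.

Section Operators.
Variables (R : realType) (k : scalar_kind) (H : hilbert_space R k).

(* The norm of [H] is valued in the scalar field (hence in [R[i]] in the
   complex case); [hnorm] is the same norm with values in [R]. *)
Definition hnorm (x : H) : R := scalar_re `|x|.

Definition bounded_operators : set (H -> H) :=
  [set T | linear T /\ continuous T].

Definition l2norm n (xi : 'I_n -> H) : R :=
  Num.sqrt (\sum_(i < n) hnorm (xi i) ^+ 2).

(* The operator norm of a matrix of operators acting on [H^n]. *)
Definition opmx_norm n (A : 'M[H -> H]_n) : R :=
  sup [set l2norm (fun i => \sum_(j < n) A i j (xi j)) |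
        xi in [set xi : 'I_n -> H | l2norm xi <= 1]].

Definition op_norm (T : H -> H) : R := opmx_norm (const_mx T : 'M[H -> H]_1).

End Operators.

Arguments bounded_operators {R k} H _.

Record operator_space (R : realType) (k : scalar_kind) := OperatorSpace {
  os_hilbert : hilbert_space R k;
  os_set : set (os_hilbert -> os_hilbert);
  os_bounded : os_set `<=` bounded_operators os_hilbert;
  os_submod : submod_closed (mem os_set);
  os_closed : forall T, bounded_operators os_hilbert T ->
    (forall e : R, 0 < e -> exists2 S, os_set S & op_norm (T - S) < e) ->
    os_set T
}.

Arguments os_set {R k} _ _.
Arguments os_submod {R k} _.

Section OperatorSpaceElements.
Variables (R : realType) (k : scalar_kind) (X : operator_space R k).

Definition os_pred : {pred os_hilbert X -> os_hilbert X} := mem (os_set X).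

HB.instance Definition _ :=
  GRing.isSubmodClosed.Build _ _ os_pred (os_submod X).

Record os_elt := OsElt {
  os_val : os_hilbert X -> os_hilbert X;
  os_valP : os_val \in os_pred
}.

HB.instance Definition _ := [isSub for os_val].
HB.instance Definition _ := [Choice of os_elt by <:].
HB.instance Definition _ := [SubChoice_isSubLmodule of os_elt by <:].

End OperatorSpaceElements.

(* Carries the data of the matrix norms without axioms; it is only
   instantiated by operator spaces and their ultrapowers, so that the two
   embedding predicates apply to both. *)
Record matrix_normed_space (R : realType) (k : scalar_kind) :=
  MatrixNormedSpace {
    mns_sort :> lmodType (scalar R k);
    mnorm : forall n, 'M[mns_sort]_n -> R
  }.

Arguments mnorm {R k m n} _.

Definition os_mns (R : realType) (k : scalar_kind) (X : operator_space R k) :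
    matrix_normed_space R k :=
  @MatrixNormedSpace R k (os_elt X)
    (fun n (A : 'M[os_elt X]_n) => opmx_norm (map_mx (@os_val R k X) A)).

Coercion os_mns : operator_space >-> matrix_normed_space.

Structure ultrafilter_on (T : Type) := UltraFilterPack {
  ultrafilter :> set_system T;
  ultrafilter_class : UltraFilter ultrafilter
}.

Global Instance ultrafilter_on_UltraFilter T (U : ultrafilter_on T) :
  UltraFilter U := ultrafilter_class U.

Definition nonprincipal T (U : ultrafilter_on T) : Prop :=
  forall x : T, ultrafilter U <> principal_filter x.

Section NormFacts.
Variables (R : realType) (k : scalar_kind).

Lemma scalar_reD (a b : scalar R k) :
  scalar_re (a + b) = scalar_re a + scalar_re b.
Proof. by case: k a b => //= -[a1 a2] [b1 b2]. Qed.

Lemma scalar_reM (a b : scalar R k) : 0 <= a ->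
  scalar_re (a * b) = scalar_re a * scalar_re b.
Proof.
case: k a b => //= a b a0; have /eqP : complex.Im a = 0 by exact: ger0_Im.
by case: a {a0} => a1 a2; case: b => b1 b2 /= /eqP ->; rewrite mul0r subr0.
Qed.

Lemma scalar_re_le (a b : scalar R k) : a <= b -> scalar_re a <= scalar_re b.
Proof. by case: k a b => //= a b; rewrite lecE => /andP[]. Qed.

Lemma of_realK (a : R) : scalar_re (of_real k a) = a.
Proof. by case: k. Qed.

Lemma re_of_real (a : scalar R k) : 0 <= a -> of_real k (scalar_re a) = a.
Proof. by case: k a => //= a a0; apply: RRe_real; apply: ger0_real. Qed.

Lemma of_real_ge0 (a : R) : 0 <= a -> 0 <= of_real k a.
Proof. by case: k => //= a0; rewrite lecR. Qed.

Lemma of_real_neq0 (a : R) : a != 0 -> of_real k a != 0.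
Proof. by case: k => //= a0; rewrite (inj_eq (@complexI R)). Qed.

Lemma scalar_re0 : scalar_re (0 : scalar R k) = 0.
Proof. by case: k. Qed.

Variable H : hilbert_space R k.

Lemma hnorm_ge0 (x : H) : 0 <= hnorm x.
Proof. by rewrite -scalar_re0; exact: scalar_re_le. Qed.

Lemma hnorm0 : hnorm (0 : H) = 0.
Proof. by rewrite /hnorm normr0 scalar_re0. Qed.

Lemma hnormD (x y : H) : hnorm (x + y) <= hnorm x + hnorm y.
Proof. by rewrite /hnorm -scalar_reD; exact/scalar_re_le/ler_normD. Qed.

Lemma hnormZ (a : scalar R k) (x : H) :
  hnorm (a *: x) = scalar_re `|a| * hnorm x.
Proof. by rewrite /hnorm normrZ scalar_reM. Qed.

Lemma hnorm_eq0 (x : H) : hnorm x = 0 -> x = 0.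
Proof.
move=> x0; apply/eqP; rewrite -normr_eq0 -(re_of_real (normr_ge0 x)).
by move: x0; rewrite /hnorm => ->; case: k.
Qed.

Lemma l2norm1 (xi : 'I_1 -> H) : l2norm xi = hnorm (xi ord0).
Proof. by rewrite /l2norm big_ord1 sqrtr_sqr ger0_norm// hnorm_ge0. Qed.

Lemma op_normE (T : H -> H) :
  op_norm T = sup [set hnorm (T x) | x in [set x | hnorm x <= 1]].
Proof.
rewrite /op_norm /opmx_norm; congr sup; apply/seteqP; split=> r /=.
  move=> [xi]; rewrite !l2norm1 big_ord1 mxE => xi1 <-.
  by exists (xi ord0).
move=> [x x1 <-]; exists (fun=> x); rewrite !l2norm1//.
by rewrite big_ord1 mxE.
Qed.

Lemma op_norm_le (T : H -> H) (C : R) : 0 <= C ->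
  (forall x, hnorm (T x) <= C * hnorm x) -> op_norm T <= C.
Proof.
move=> C0 TC; rewrite op_normE; apply: ge_sup.
  by exists (hnorm (T 0)), 0 => //=; rewrite hnorm0.
by move=> _ [x /= x1 <-]; rewrite (le_trans (TC x))// ler_piMr.
Qed.

Lemma bounded_operator_le (T : H -> H) : bounded_operators H T ->
  exists2 C : R, 0 <= C & forall x, hnorm (T x) <= C * hnorm x.
Proof.
move=> [linT cT].
pose lT := GRing.isLinear.Build _ _ _ _ T linT.
pose L : {linear H -> H} := HB.pack T lT.
have : bounded_near L (nbhs (0 : H)).
  exact: (@continuous_linear_bounded _ _ _ 0 L (cT 0)).
move/linear_boundedP/pinfty_ex_gt0 => [M M0 LM].
exists (scalar_re M).
  by rewrite -scalar_re0; exact/scalar_re_le/ltW.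
by move=> x; rewrite /hnorm -scalar_reM ?(ltW M0)//; exact/scalar_re_le/LM.
Qed.

Lemma op_normP (T : H -> H) (x : H) : bounded_operators H T ->
  hnorm (T x) <= op_norm T * hnorm x.
Proof.
move=> bT; have [C C0 TC] := bounded_operator_le bT.
have linT : linear T by case: bT.
have [x0|x0] := eqVneq (hnorm x) 0.
  by rewrite (le_trans (TC x))// x0 !mulr0.
have xgt0 : 0 < hnorm x by rewrite lt_def x0 hnorm_ge0.
pose a : scalar R k := of_real k (hnorm x)^-1.
have a0 : 0 <= a by rewrite of_real_ge0// invr_ge0 hnorm_ge0.
have na : scalar_re `|a| = (hnorm x)^-1 by rewrite ger0_norm// of_realK.
have Ta : T (a *: x) = a *: T x.
  pose lT := GRing.isLinear.Build _ _ _ _ T linT.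
  pose L : {linear H -> H} := HB.pack T lT.
  exact: (linearZ_LR L).
suff : hnorm (T (a *: x)) <= op_norm T.
  by rewrite Ta hnormZ na ler_pdivrMl// mulrC.
rewrite op_normE; apply: ub_le_sup.
  exists C => _ [y /= y1 <-]; rewrite (le_trans (TC y))// ler_piMr//.
by exists (a *: x) => //=; rewrite hnormZ na mulVf.
Qed.

Lemma op_norm_ge0 (T : H -> H) : bounded_operators H T -> 0 <= op_norm T.
Proof.
move=> bT; have [C C0 TC] := bounded_operator_le bT.
rewrite op_normE; apply: (@le_trans _ _ (hnorm (T 0))); first exact: hnorm_ge0.
apply: ub_le_sup; last by exists 0 => //=; rewrite hnorm0.
by exists C => _ [y /= y1 <-]; rewrite (le_trans (TC y))// ler_piMr.
Qed.

Lemma op_norm_linear (a : scalar R k) (S T : H -> H) :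
  bounded_operators H S -> bounded_operators H T ->
  op_norm (a *: S + T) <= scalar_re `|a| * op_norm S + op_norm T.
Proof.
move=> bS bT.
have a0 : 0 <= scalar_re `|a| by rewrite -scalar_re0; exact: scalar_re_le.
apply: op_norm_le.
  by rewrite addr_ge0// ?mulr_ge0// op_norm_ge0.
move=> x; rewrite -[(a *: S + T) x]/(a *: S x + T x).
rewrite (le_trans (hnormD _ _))// hnormZ mulrDl -mulrA.
by rewrite lerD ?ler_wpM2l// op_normP.
Qed.

End NormFacts.

Section Norm1.
Variables (R : realType) (k : scalar_kind) (Y : operator_space R k).

Definition os_norm (y : Y) : R := op_norm (os_val y).

Lemma os_valB (y : Y) : bounded_operators _ (os_val y).
Proof. by apply: os_bounded; have := os_valP y; rewrite inE. Qed.

Lemma os_norm_ge0 (y : Y) : 0 <= os_norm y.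
Proof. exact/op_norm_ge0/os_valB. Qed.

Lemma os_norm_linear (a : scalar R k) (y z : Y) :
  os_norm (a *: y + z) <= scalar_re `|a| * os_norm y + os_norm z.
Proof. exact: op_norm_linear (os_valB y) (os_valB z). Qed.

Lemma os_norm0 : os_norm 0 = 0.
Proof.
apply/le_anti; rewrite os_norm_ge0 andbT.
apply: op_norm_le => // x; rewrite mul0r -[os_val 0 x]/(0 : os_hilbert Y).
by rewrite hnorm0.
Qed.

End Norm1.

Section BoundedSequences.
Variables (R : realType) (k : scalar_kind) (Y : operator_space R k).

Definition bounded_seq_pred : {pred nat -> Y} :=
  mem [set y | exists M : R, forall m, os_norm (y m) <= M].

Lemma bounded_seq_submod : submod_closed bounded_seq_pred.
Proof.
split=> [|a y z]; rewrite !inE /=.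
  by exists 0 => m; rewrite os_norm0.
move=> [M yM] [N zN]; exists (scalar_re `|a| * M + N) => m.
rewrite (le_trans (os_norm_linear _ _ _))// lerD// ler_wpM2l//.
by rewrite -(scalar_re0 R k); exact: scalar_re_le.
Qed.

HB.instance Definition _ :=
  GRing.isSubmodClosed.Build _ _ bounded_seq_pred bounded_seq_submod.

Record bounded_seq := BoundedSeq {
  bseq_val :> nat -> Y;
  bseq_valP : bseq_val \in bounded_seq_pred
}.

HB.instance Definition _ := [isSub for bseq_val].
HB.instance Definition _ := [Choice of bounded_seq by <:].
HB.instance Definition _ := [SubChoice_isSubLmodule of bounded_seq by <:].

Variable U : ultrafilter_on nat.

Definition null_seq_pred : {pred bounded_seq} :=
  mem [set y : bounded_seq | os_norm (y m) @[m --> ultrafilter U] --> (0 : R)].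

Lemma null_seq_submod : submod_closed null_seq_pred.
Proof.
split=> [|a y z]; rewrite !inE /=.
  under eq_fun do rewrite os_norm0; exact: cvg_cst.
move=> y0 z0.
have h : scalar_re `|a| * os_norm (y m) + os_norm (z m)
    @[m --> ultrafilter U] --> (0 : R).
  rewrite -(addr0 (0 : R)) -{1}(mulr0 (scalar_re `|a|)).
  by apply: cvgD => //; apply: cvgM => //; exact: cvg_cst.
apply: (squeeze_cvgr _ (@cvg_cst _ (0 : R) _ _ _) h).
by apply: nearW => m /=; rewrite os_norm_ge0 os_norm_linear.
Qed.

HB.instance Definition _ :=
  GRing.isSubmodClosed.Build _ _ null_seq_pred null_seq_submod.

End BoundedSequences.

Section Ultrapower.
Variables (R : realType) (k : scalar_kind) (Y : operator_space R k).
Variable U : ultrafilter_on nat.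

Local Open Scope quotient_scope.

Definition ultrapower_sort : Type := Quotient.quot (null_seq_pred (Y:=Y) U).

HB.instance Definition _ := Choice.on ultrapower_sort.
HB.instance Definition _ := GRing.Zmodule.on ultrapower_sort.
HB.instance Definition _ : EqQuotient _ _ ultrapower_sort :=
  EqQuotient.on ultrapower_sort.
HB.instance Definition _ := isZmodQuotient.Build _
  (Quotient.equiv (null_seq_pred (Y:=Y) U)) 0 -%R +%R ultrapower_sort
  (@pi_zeror _ _ _ _ _ (Quotient.quot (null_seq_pred (Y:=Y) U)))
  (@pi_oppr _ _ _ _ _ (Quotient.quot (null_seq_pred (Y:=Y) U)))
  (@pi_addr _ _ _ _ _ (Quotient.quot (null_seq_pred (Y:=Y) U))).

Definition ultrapower_scale (a : scalar R k) :=
  lift_op1 ultrapower_sort (fun y : bounded_seq Y => a *: y).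

Lemma pi_scale a :
  {morph \pi_ultrapower_sort : y / a *: y >-> ultrapower_scale a y}.
Proof.
move=> y; rewrite /ultrapower_scale; unlock; apply/eqP.
rewrite -Quotient.idealrBE -scalerBr rpredZ// Quotient.idealrBE.
by rewrite reprK.
Qed.

Fact ultrapower_scalerA a b v :
  ultrapower_scale a (ultrapower_scale b v) = ultrapower_scale (a * b) v.
Proof. by rewrite -[v]reprK -!pi_scale scalerA. Qed.

Fact ultrapower_scale1r : left_id 1 ultrapower_scale.
Proof. by move=> v; rewrite -[v]reprK -pi_scale scale1r. Qed.

Fact ultrapower_scalerDr : right_distributive ultrapower_scale +%R.
Proof.
move=> a u v; rewrite -[u]reprK -[v]reprK.
by rewrite -!pi_addr -!pi_scale -pi_addr scalerDr.
Qed.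

Fact ultrapower_scalerDl v : {morph ultrapower_scale^~ v : a b / a + b}.
Proof.
by move=> a b /=; rewrite -[v]reprK -!pi_scale -pi_addr scalerDl.
Qed.

HB.instance Definition _ := GRing.Zmodule_isLmodule.Build _ ultrapower_sort
  ultrapower_scalerA ultrapower_scale1r ultrapower_scalerDr
  ultrapower_scalerDl.

(* [repr] picks a bounded sequence representing a class; the limit does not
   depend on that choice. *)
Definition ultrapower : matrix_normed_space R k :=
  @MatrixNormedSpace R k ultrapower_sort
    (fun n (A : 'M[ultrapower_sort]_n) =>
       lim (mnorm (\matrix_(i, j) (repr (A i j) : bounded_seq Y) m)
              @[m --> ultrafilter U])).

End Ultrapower.

Section Embeddings.
Variables (R : realType) (k : scalar_kind).
Implicit Types X Y Z : matrix_normed_space R k.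

Definition almost_completely_coarsely_embeds X Y : Prop :=
  exists rho omega : R -> R,
    [/\ forall t, 0 <= t -> 0 <= rho t,
        forall t, 0 <= t -> 0 <= omega t,
        rho t @[t --> +oo] --> +oo &
        exists f : nat -> X -> Y, forall n, (0 < n)%N -> forall x y : 'M[X]_n,
          rho (mnorm (x - y))
            <= mnorm (map_mx (f n) x - map_mx (f n) y)
            <= omega (mnorm (x - y))].

Definition real_linear X Z (u : X -> Z) : Prop :=
  forall (a : R) (x y : X),
    u (of_real k a *: x + y) = of_real k a *: u x + u y.

(* [D] is the domain of [u], a subset of [X]. *)
Definition completely_bounded_on X Z (D : set X) (u : X -> Z) : Prop :=
  exists C : R, forall n, (0 < n)%N -> forall x : 'M[X]_n,
    (forall i j, D (x i j)) -> mnorm (map_mx u x) <= C * mnorm x.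

Definition completely_real_isomorphically_embeds X Z : Prop :=
  exists u : X -> Z,
    [/\ real_linear u, injective u, completely_bounded_on setT u &
        exists2 v : Z -> X, cancel u v & completely_bounded_on (range u) v].

End Embeddings.

(* Main.v *)
From HB Require Import structures.
From mathcomp Require Import all_boot all_order all_algebra.
From mathcomp Require Import all_classical all_reals all_analysis.
From mathcomp Require Import sesquilinear complex lra ring.
Require Import Defs.

(* Let f^n be the maps of an almost complete coarse embedding.  A Hadamard
   matrix of size N = 4^p multiplied by x has norm 2^p |x| and is reached from 0
   in 2^p steps of norm |x|, so for n >= N the matrix with entries
   f^n(z +- x) - f^n(z) has norm at most 2^p omega(|x|).  Adding the estimate
   for the opposite matrix gives the constant matrix with entry
   w = f^n(z + x) + f^n(z - x) - 2 f^n(z), whose norm is 4^p |w|; hence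
   |w| <= 2 omega(|x|) / 2^p.  In the ultrapower the class F(x) of
   (f^n(x) - f^n(0))_n is therefore additive in x.  Rotation matrices bound F on
   the segment from 0 to x, so F is real-linear, and by homogeneity the coarse
   bounds at a single scale become the linear bounds of a complete
   isomorphism. *)

Set Implicit Arguments.
Unset Strict Implicit.
Unset Printing Implicit Defensive.

Import Order.TTheory GRing.Theory Num.Theory.
Import numFieldNormedType.Exports.

Local Open Scope classical_set_scope.
Local Open Scope ring_scope.
Local Open Scope quotient_scope.

(** * Finite families in a Hilbert space *)

Section RealScalars.
Variables (R : realType) (k : scalar_kind).
Implicit Types (a b : R) (z : scalar R k).

Lemma of_realD a b : of_real k (a + b) = of_real k a + of_real k b.
Proof. by case: k => //=; rewrite rmorphD. Qed.

Lemma of_realM a b : of_real k (a * b) = of_real k a * of_real k b.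
Proof. by case: k => //=; rewrite rmorphM. Qed.

Lemma of_real1 : of_real k (1 : R) = 1.
Proof. by case: k. Qed.

Lemma of_real0 : of_real k (0 : R) = 0.
Proof. by case: k. Qed.

Lemma of_realN a : of_real k (- a) = - of_real k a.
Proof. by case: k => //=; rewrite rmorphN. Qed.

Lemma of_real_nat n : of_real k (n%:R : R) = n%:R.
Proof. by case: k => //=; rewrite rmorph_nat. Qed.

Lemma scalar_conj_of_real a : scalar_conj (of_real k a) = of_real k a.
Proof. by case: k => //=; rewrite oppr0. Qed.

(** The real factor may be negative here, unlike in [scalar_reM]; sign and rotation matrices have
    negative entries. *)
Lemma scalar_re_of_realM a z : scalar_re (of_real k a * z) = a * scalar_re z.
Proof. by case: k z => //= -[x y] /=; rewrite mul0r subr0. Qed.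

Lemma scalar_re_norm_of_real a : scalar_re `|of_real k a| = `|a|.
Proof.
case: k => //=.
by rewrite expr0n addr0 sqrtr_sqr.
Qed.

End RealScalars.

Section RealInnerProduct.
Variables (R : realType) (k : scalar_kind) (H : hilbert_space R k).
Implicit Types x y : H.

(** The real part gives one real-valued form for both scalar fields, and real coefficients come out
    of it on either side. *)
Definition real_inner x y : R := scalar_re (hilbert_inner H x y).

Lemma hnormE x : hnorm x ^+ 2 = real_inner x x.
Proof. by rewrite /real_inner -hilbert_normE expr2 scalar_reM. Qed.

Lemma scalar_re_sum (I : Type) (r : seq I) (F : I -> scalar R k) :
  scalar_re (\sum_(i <- r) F i) = \sum_(i <- r) scalar_re (F i).
Proof.
exact: (big_morph _ (@scalar_reD R k) (scalar_re0 R k)).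
Qed.

Lemma real_inner_sum (I J : finType) (a : I -> R) (b : J -> R)
    (x : I -> H) (y : J -> H) :
  real_inner (\sum_i of_real k (a i) *: x i) (\sum_j of_real k (b j) *: y j) =
  \sum_i \sum_j a i * b j * real_inner (x i) (y j).
Proof.
rewrite /real_inner linear_sumlz scalar_re_sum; apply: eq_bigr => i _.
rewrite linear_sumr scalar_re_sum; apply: eq_bigr => j _.
rewrite linearZl_LR linearZr_LR /= scalar_conj_of_real.
by rewrite !scalar_re_of_realM mulrA.
Qed.

End RealInnerProduct.

Section L2Norm.
Variables (R : realType) (k : scalar_kind) (H : hilbert_space R k) (n : nat).
Implicit Types xi eta : 'I_n -> H.

Lemma l2norm_ge0 xi : 0 <= l2norm xi.
Proof. exact: sqrtr_ge0. Qed.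

Lemma l2norm_sqr xi : l2norm xi ^+ 2 = \sum_(i < n) hnorm (xi i) ^+ 2.
Proof. by rewrite sqr_sqrtr// sumr_ge0// => i _; rewrite sqr_ge0. Qed.

(** Comparing squared sums avoids square roots. The lengths [n] and [m] may differ, so a zero-padded
    family can be compared with a shorter one. *)
Lemma l2norm_eq m (xi : 'I_n -> H) (eta : 'I_m -> H) c : 0 <= c ->
  \sum_i hnorm (xi i) ^+ 2 = c ^+ 2 * \sum_i hnorm (eta i) ^+ 2 ->
  l2norm xi = c * l2norm eta.
Proof.
move=> c0 E; rewrite /l2norm E sqrtrM ?sqr_ge0// sqrtr_sqr ger0_norm//.
Qed.

Lemma hnorm_le_l2norm xi i : hnorm (xi i) <= l2norm xi.
Proof.
rewrite -(@ler_pXn2r _ 2) ?nnegrE ?hnorm_ge0 ?l2norm_ge0//.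
rewrite l2norm_sqr (bigD1 i)//= lerDl sumr_ge0// => j _; exact: sqr_ge0.
Qed.

Lemma l2norm_le_sum xi : l2norm xi <= \sum_i hnorm (xi i).
Proof.
have s0 : 0 <= \sum_i hnorm (xi i) by apply: sumr_ge0 => i _; exact: hnorm_ge0.
rewrite -(@ler_pXn2r _ 2) ?nnegrE ?l2norm_ge0// l2norm_sqr expr2 mulr_suml.
apply: ler_sum => i _; rewrite expr2 ler_wpM2l ?hnorm_ge0//.
by rewrite (bigD1 i)//= lerDl sumr_ge0// => j _; exact: hnorm_ge0.
Qed.

Lemma l2normZ (c : R) xi :
  l2norm (fun i => of_real k c *: xi i) = `|c| * l2norm xi.
Proof.
apply: l2norm_eq => //; rewrite mulr_sumr; apply: eq_bigr => i _.
by rewrite hnormZ scalar_re_norm_of_real exprMn.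
Qed.

(** Cauchy-Schwarz for the sequences of norms. With [a] and [b] the two $\ell_2$ norms, summing
    $(b|\xi_i| - a|\eta_i|)^2 \ge 0$ bounds $2ab$ times the left side by $2(ab)^2$; the case $ab =
    0$ is separate because $2ab$ is cancelled. *)
Lemma sum_mul_hnorm_le xi eta :
  \sum_i hnorm (xi i) * hnorm (eta i) <= l2norm xi * l2norm eta.
Proof.
have ge0 : 0 <= l2norm xi * l2norm eta by rewrite mulr_ge0 ?l2norm_ge0.
have [s0|s0] := eqVneq (l2norm xi * l2norm eta) 0.
  rewrite s0 le_eqVlt; apply/orP; left; rewrite big1// => i _.
  apply/le_anti; rewrite mulr_ge0 ?hnorm_ge0// -s0 andbT.
  by rewrite ler_pM ?hnorm_ge0// hnorm_le_l2norm.
have {ge0} gt0 : 0 < l2norm xi * l2norm eta by rewrite lt_def s0.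
have gt2 : 0 < 2 * (l2norm xi * l2norm eta) by rewrite mulr_gt0.
rewrite -(ler_pM2l gt2).
rewrite mulr_sumr.
have -> : 2 * (l2norm xi * l2norm eta) * (l2norm xi * l2norm eta) =
    \sum_i (l2norm eta ^+ 2 * hnorm (xi i) ^+ 2 +
            l2norm xi ^+ 2 * hnorm (eta i) ^+ 2).
  by rewrite big_split /= -!mulr_sumr -!l2norm_sqr; ring.
apply: ler_sum => i _; rewrite -subr_ge0.
set a := l2norm xi; set b := l2norm eta.
have -> : b ^+ 2 * hnorm (xi i) ^+ 2 + a ^+ 2 * hnorm (eta i) ^+ 2 -
   2 * (a * b) * (hnorm (xi i) * hnorm (eta i)) =
   (b * hnorm (xi i) - a * hnorm (eta i)) ^+ 2 by ring.
exact: sqr_ge0.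
Qed.

Lemma l2normD xi eta :
  l2norm (fun i => xi i + eta i) <= l2norm xi + l2norm eta.
Proof.
rewrite -(@ler_pXn2r _ 2) ?nnegrE ?addr_ge0 ?l2norm_ge0// l2norm_sqr.
apply: (@le_trans _ _ (\sum_i (hnorm (xi i) + hnorm (eta i)) ^+ 2)).
  apply: ler_sum => i _; rewrite ler_pXn2r ?nnegrE ?addr_ge0 ?hnorm_ge0//.
  exact: hnormD.
under eq_bigr do rewrite sqrrD.
rewrite 2!big_split /= -!l2norm_sqr sqrrD lerD2r lerD2l.
by rewrite sumrMnl lerMn2r sum_mul_hnorm_le.
Qed.

End L2Norm.

Lemma l2norm_split (R : realType) (k : scalar_kind) (H : hilbert_space R k)
    m n (xi : 'I_(m + n) -> H) :
  l2norm xi ^+ 2 = l2norm (fun i => xi (lshift n i)) ^+ 2 +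
                   l2norm (fun i => xi (rshift m i)) ^+ 2.
Proof. by rewrite !l2norm_sqr big_split_ord. Qed.

(* The orthogonality relations make the cross terms of the squares cancel. *)
Lemma l2norm_orthogonal (R : realType) (k : scalar_kind) (H : hilbert_space R k)
    n (c : 'M[R]_n) (lambda : R) (xi : 'I_n -> H) :
  0 <= lambda -> c^T *m c = (lambda ^+ 2)%:M ->
  l2norm (fun i => \sum_j of_real k (c i j) *: xi j) = lambda * l2norm xi.
Proof.
move=> l0 cE; apply: l2norm_eq => //.
under eq_bigr do rewrite hnormE real_inner_sum.
rewrite exchange_big mulr_sumr; apply: eq_bigr => j _ /=.
rewrite exchange_big /= (bigD1 j)//= [X in _ + X]big1 ?addr0 => [|l lj].
  rewrite -mulr_suml hnormE; congr (_ * _).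
  have /matrixP/(_ j j) := cE; rewrite !mxE eqxx mulr1n => <-.
  by apply: eq_bigr => i _; rewrite mxE.
have cjl : \sum_i c i j * c i l = 0.
  have /matrixP/(_ j l) := cE; rewrite !mxE eq_sym (negbTE lj) mulr0n.
  by under eq_bigr do rewrite mxE.
by rewrite -mulr_suml cjl mul0r.
Qed.

(** * Norms of operator matrices *)

Section OperatorMatrices.
Variables (R : realType) (k : scalar_kind) (H : hilbert_space R k).

Lemma bounded_operator_linear (T : H -> H) : bounded_operators H T ->
  exists L : {linear H -> H}, T = L.
Proof.
move=> [linT _]; pose lT := GRing.isLinear.Build _ _ _ _ T linT.
by pose L : {linear H -> H} := HB.pack T lT; exists L.
Qed.

Definition opmx_act n (A : 'M[H -> H]_n) (xi : 'I_n -> H) : 'I_n -> H :=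
  fun i => \sum_(j < n) A i j (xi j).

Definition bounded_opmx n (A : 'M[H -> H]_n) : Prop :=
  forall i j, bounded_operators H (A i j).

Section FixedSize.
Variables (n : nat) (A : 'M[H -> H]_n).
Implicit Types xi eta : 'I_n -> H.

Lemma hnorm_sum (I : Type) (r : seq I) (F : I -> H) :
  hnorm (\sum_(i <- r) F i) <= \sum_(i <- r) hnorm (F i).
Proof.
elim/big_ind2 : _ => //; first by rewrite hnorm0.
by move=> x a y b xa yb; rewrite (le_trans (hnormD _ _))// lerD.
Qed.

Lemma l2norm0 : l2norm (fun _ : 'I_n => 0 : H) = 0.
Proof. by rewrite /l2norm hnorm0 expr0n sumr_const mul0rn sqrtr0. Qed.

Lemma l2norm_eq0 xi : l2norm xi = 0 -> xi = (fun=> 0).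
Proof.
move=> xi0; apply/funext => i; apply: hnorm_eq0; apply/le_anti.
by rewrite hnorm_ge0 andbT -xi0 hnorm_le_l2norm.
Qed.

(** This crude bound makes the set in the definition of [opmx_norm] bounded above, so that its
    supremum dominates its members. *)
Lemma opmx_act_le_sum xi : bounded_opmx A ->
  l2norm (opmx_act A xi) <= (\sum_i \sum_j op_norm (A i j)) * l2norm xi.
Proof.
move=> bA; rewrite (le_trans (l2norm_le_sum _))// mulr_suml.
apply: ler_sum => i _; rewrite (le_trans (hnorm_sum _ _))// mulr_suml.
apply: ler_sum => j _; rewrite (le_trans (op_normP _ (bA i j)))//.
by rewrite ler_wpM2l ?op_norm_ge0// hnorm_le_l2norm.
Qed.

Lemma opmx_norm_le (C : R) : 0 <= C ->
  (forall xi, l2norm (opmx_act A xi) <= C * l2norm xi) -> opmx_norm A <= C.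
Proof.
move=> C0 AC; apply: ge_sup.
  by exists (l2norm (opmx_act A (fun=> 0))), (fun=> 0) => //=; rewrite l2norm0.
by move=> _ [xi /= xi1 <-]; rewrite (le_trans (AC xi))// ler_piMr.
Qed.

Hypothesis bA : bounded_opmx A.

Lemma sum_op_norm_ge0 : 0 <= \sum_i \sum_j op_norm (A i j).
Proof. by do 2!apply: sumr_ge0 => ? _; exact: op_norm_ge0. Qed.

Lemma opmx_norm_le_sum : opmx_norm A <= \sum_i \sum_j op_norm (A i j).
Proof.
by apply: opmx_norm_le sum_op_norm_ge0 _ => xi; exact: opmx_act_le_sum.
Qed.

Lemma opmx_norm_ub xi : l2norm xi <= 1 -> l2norm (opmx_act A xi) <= opmx_norm A.
Proof.
move=> xi1; apply: ub_le_sup; last by exists xi.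
exists (\sum_i \sum_j op_norm (A i j)) => _ [eta /= eta1 <-].
by rewrite (le_trans (opmx_act_le_sum _ bA))// ler_piMr// sum_op_norm_ge0.
Qed.

Lemma opmx_norm_ge0 : 0 <= opmx_norm A.
Proof.
rewrite (le_trans _ (@opmx_norm_ub (fun=> 0) _)) ?l2norm_ge0//.
by rewrite l2norm0.
Qed.

Lemma opmx_actZ (c : R) xi :
  opmx_act A (fun i => of_real k c *: xi i) =
  (fun i => of_real k c *: opmx_act A xi i).
Proof.
apply/funext => i; rewrite /opmx_act scaler_sumr; apply: eq_bigr => j _.
by have [L ->] := bounded_operator_linear (bA i j); rewrite linearZ.
Qed.

Lemma opmx_act0 : opmx_act A (fun=> 0) = (fun=> 0).
Proof.
apply/funext => i; rewrite /opmx_act big1// => j _.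
by have [L ->] := bounded_operator_linear (bA i j); rewrite linear0.
Qed.

Lemma opmx_normP xi : l2norm (opmx_act A xi) <= opmx_norm A * l2norm xi.
Proof.
have [xi0|xi0] := eqVneq (l2norm xi) 0.
  by rewrite xi0 mulr0 (l2norm_eq0 xi0) opmx_act0 l2norm0.
have xigt0 : 0 < l2norm xi by rewrite lt_def xi0 l2norm_ge0.
rewrite -ler_pdivrMr// mulrC -[X in X * _]ger0_norm ?invr_ge0 ?l2norm_ge0//.
rewrite -l2normZ -opmx_actZ; apply: opmx_norm_ub.
by rewrite l2normZ ger0_norm ?invr_ge0 ?l2norm_ge0// mulVf.
Qed.

Lemma opmx_norm_entry i j : op_norm (A i j) <= opmx_norm A.
Proof.
apply: op_norm_le => [|x]; first exact: opmx_norm_ge0.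
(* The test vector carries [x] in coordinate [j] only, so coordinate [i] of its image is the value
   of the entry at [x]. *)
pose xi := fun l : 'I_n => if l == j then x else 0.
have <- : l2norm xi = hnorm x.
  rewrite -[RHS]mul1r -l2norm1; apply: (l2norm_eq (eta := fun=> x)) => //.
  rewrite big_ord1 expr1n mul1r (bigD1 j)//= /xi eqxx big1 ?addr0// => l lj.
  by rewrite (negbTE lj) hnorm0 expr0n.
have -> : A i j x = opmx_act A xi i.
  rewrite /opmx_act (bigD1 j)//= /xi eqxx big1 ?addr0// => l lj.
  rewrite (negbTE lj).
  by have [L ->] := bounded_operator_linear (bA i l); rewrite linear0.
by rewrite (le_trans (hnorm_le_l2norm _ _))// opmx_normP.
Qed.

End FixedSize.

End OperatorMatrices.

(** * Matrix norms over an operator space *)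

Section MatrixNorms.
Variables (R : realType) (k : scalar_kind) (X : operator_space R k).
Local Notation H := (os_hilbert X).

Definition os_act n (A : 'M[X]_n) : ('I_n -> H) -> 'I_n -> H :=
  opmx_act (map_mx (@os_val R k X) A).

Lemma bounded_os_mx n (A : 'M[X]_n) : bounded_opmx (map_mx (@os_val R k X) A).
Proof. by move=> i j; rewrite mxE; exact: os_valB. Qed.

Lemma os_actE n (A : 'M[X]_n) xi i :
  os_act A xi i = \sum_j os_val (A i j) (xi j).
Proof. by apply: eq_bigr => j _; rewrite mxE. Qed.

Lemma mnorm_le n (A : 'M[X]_n) (C : R) : 0 <= C ->
  (forall xi, l2norm (os_act A xi) <= C * l2norm xi) -> mnorm A <= C.
Proof. exact: opmx_norm_le. Qed.

Lemma mnormP n (A : 'M[X]_n) xi : l2norm (os_act A xi) <= mnorm A * l2norm xi.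
Proof. exact: opmx_normP (bounded_os_mx A) xi. Qed.

Lemma mnorm_ge0 n (A : 'M[X]_n) : 0 <= mnorm A.
Proof. exact: opmx_norm_ge0 (bounded_os_mx A). Qed.

Lemma mnorm_entry n (A : 'M[X]_n) i j : os_norm (A i j) <= mnorm A.
Proof.
by have := opmx_norm_entry (bounded_os_mx A) i j; rewrite mxE.
Qed.

Lemma mnorm_le_sum n (A : 'M[X]_n) : mnorm A <= \sum_i \sum_j os_norm (A i j).
Proof.
have := opmx_norm_le_sum (bounded_os_mx A).
by under eq_bigr do under eq_bigr do rewrite mxE.
Qed.

Lemma mnorm0 n : mnorm (0 : 'M[X]_n) = 0.
Proof.
apply/le_anti; rewrite mnorm_ge0 andbT (le_trans (mnorm_le_sum _))//.
by rewrite big1// => i _; rewrite big1// => j _; rewrite mxE os_norm0.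
Qed.

Lemma os_norm_eq0 (x : X) : os_norm x = 0 -> x = 0.
Proof.
move=> x0; apply: val_inj; apply/funext => h; apply: hnorm_eq0.
apply/le_anti; rewrite hnorm_ge0 andbT.
by have := op_normP h (os_valB x); rewrite [op_norm _]x0 mul0r.
Qed.

Lemma mnorm_eq0 n (A : 'M[X]_n) : mnorm A = 0 -> A = 0.
Proof.
move=> A0; apply/matrixP => i j; rewrite mxE; apply: os_norm_eq0.
by apply/le_anti; rewrite os_norm_ge0 andbT -A0 mnorm_entry.
Qed.

Lemma mnormD n (A B : 'M[X]_n) : mnorm (A + B) <= mnorm A + mnorm B.
Proof.
apply: mnorm_le => [|xi]; first by rewrite addr_ge0 ?mnorm_ge0.
have -> : os_act (A + B) xi = fun i => os_act A xi i + os_act B xi i.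
  apply/funext => i; rewrite !os_actE -big_split; apply: eq_bigr => j _.
  by rewrite mxE.
by rewrite (le_trans (l2normD _ _))// mulrDl lerD ?mnormP.
Qed.

(** The module [V] is arbitrary so that the same scaling applies to matrices over [X], over bounded
    sequences and over the ultrapower. *)
Definition rscale_mx (V : lmodType (Defs.scalar R k)) n (c : R) (A : 'M[V]_n) :
    'M[V]_n :=
  map_mx (fun x => of_real k c *: x) A.

Lemma mnormZ n (c : R) (A : 'M[X]_n) :
  mnorm (rscale_mx c A) = `|c| * mnorm A.
Proof.
(* The inequality for all scalars suffices: applied to $c^{-1}$ and the scaled matrix, it gives the
   reverse one. *)
have le (d : R) (B : 'M[X]_n) : mnorm (rscale_mx d B) <= `|d| * mnorm B.
  apply: mnorm_le => [|xi]; first by rewrite mulr_ge0 ?mnorm_ge0.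
  have -> : os_act (rscale_mx d B) xi = fun i => of_real k d *: os_act B xi i.
    apply/funext => i; rewrite !os_actE scaler_sumr; apply: eq_bigr => j _.
    by rewrite mxE.
  by rewrite l2normZ -mulrA ler_wpM2l// mnormP.
apply/le_anti/andP; split; first exact: le.
have [->|c0] := eqVneq c 0; first by rewrite normr0 mul0r mnorm_ge0.
have {1}-> : A = rscale_mx c^-1 (rscale_mx c A).
  apply/matrixP => i j; rewrite !mxE scalerA -of_realM mulVf//.
  by rewrite of_real1 scale1r.
by rewrite -ler_pdivlMl ?normr_gt0// -normfV; exact: le.
Qed.

Lemma mnormN n (A : 'M[X]_n) : mnorm (- A) = mnorm A.
Proof.
rewrite -[RHS]mul1r -(normrN1 R) -mnormZ; congr mnorm; apply/matrixP => i j.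
by rewrite !mxE of_realN of_real1 scaleN1r.
Qed.

Lemma mnorm1 (x : X) : mnorm (const_mx x : 'M[X]_1) = os_norm x.
Proof. by rewrite /mnorm/= map_const_mx. Qed.

Lemma os_normP (x : X) h : hnorm (os_val x h) <= os_norm x * hnorm h.
Proof. exact: op_normP (os_valB x). Qed.

Lemma os_norm_le (x : X) C : 0 <= C ->
  (forall h, hnorm (os_val x h) <= C * hnorm h) -> os_norm x <= C.
Proof. exact: op_norm_le. Qed.

(** The padded matrix sees only the first [n] coordinates. Restricting a vector to them does not
    increase its norm, and extending one by zero preserves it. *)
Lemma mnorm_pad n l (A : 'M[X]_n) :
  mnorm (block_mx A 0 0 0 : 'M[X]_(n + l)) = mnorm A.
Proof.
have actE xi i : os_act (block_mx A 0 0 0 : 'M[X]_(n + l)) xi i =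
    match fintype.split i with
    | inl i' => os_act A (fun j => xi (lshift l j)) i'
    | inr _ => 0
    end.
  rewrite os_actE big_split_ord /=.
  case: (splitP i) => i' ii'.
    have -> : i = lshift l i' by exact: val_inj.
    rewrite [X in _ + X]big1 ?addr0 => [|j _]; last first.
      by rewrite block_mxEur mxE.
    by rewrite os_actE; apply: eq_bigr => j _; rewrite block_mxEul.
  have -> : i = rshift n i' by exact: val_inj.
  rewrite !big1 ?addr0// => j _; first by rewrite block_mxEdr mxE.
  by rewrite block_mxEdl mxE.
have normE xi : l2norm (os_act (block_mx A 0 0 0 : 'M[X]_(n + l)) xi) =
    l2norm (os_act A (fun j => xi (lshift l j))).
  rewrite -[RHS]mul1r; apply: l2norm_eq => //.
  rewrite expr1n mul1r big_split_ord /= [X in _ + X]big1 ?addr0 => [|i _].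
    apply: eq_bigr => i _; rewrite actE.
    by rewrite -[lshift l i]/(unsplit (inl i)) unsplitK.
  by rewrite actE -[rshift n i]/(unsplit (inr i)) unsplitK hnorm0 expr0n.
apply/le_anti/andP; split; apply: mnorm_le; rewrite ?mnorm_ge0// => xi.
  rewrite normE (le_trans (mnormP _ _))// ler_wpM2l ?mnorm_ge0//.
  rewrite -(@ler_pXn2r _ 2) ?nnegrE ?l2norm_ge0// [leRHS]l2norm_split lerDl.
  exact: sqr_ge0.
pose eta (i : 'I_(n + l)) := if fintype.split i is inl j then xi j else 0.
have etal : (fun j => eta (lshift l j)) = xi.
  by apply/funext => j; rewrite /eta -[lshift l j]/(unsplit (inl j)) unsplitK.
have <- : l2norm eta = l2norm xi.
  rewrite -[RHS]mul1r; apply: l2norm_eq => //.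
  rewrite expr1n mul1r big_split_ord /= [X in _ + X]big1 ?addr0 => [|i _].
    by apply: eq_bigr => i _; rewrite -[X in _ = hnorm (X i) ^+ _]etal.
  by rewrite /eta -[rshift n i]/(unsplit (inr i)) unsplitK hnorm0 expr0n.
by rewrite -{1}etal -normE mnormP.
Qed.

(** The elementary tensor $c \otimes x$ with a real matrix [c]. *)
Definition tensor_mx (V : lmodType (Defs.scalar R k)) n (c : 'M[R]_n) (x : V) :
    'M[V]_n :=
  \matrix_(i, j) (of_real k (c i j) *: x).

(** Here [c] is [lambda] times an orthogonal matrix, so $c \otimes x$ is the diagonal action of [x]
    followed by [lambda] times an isometry. A vector supported on one coordinate shows that the norm
    of [x] is attained in the lower bound. *)
Lemma mnorm_tensor n (c : 'M[R]_n) (lambda : R) (x : X) : (0 < n)%N ->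
  0 <= lambda -> c^T *m c = (lambda ^+ 2)%:M ->
  mnorm (tensor_mx c x) = lambda * os_norm x.
Proof.
case: n c => // n c _ l0 cE.
have actE xi : l2norm (os_act (tensor_mx c x) xi) =
    lambda * l2norm (fun j => os_val x (xi j)).
  rewrite -(l2norm_orthogonal _ l0 cE); congr l2norm; apply/funext => i.
  by rewrite os_actE; apply: eq_bigr => j _; rewrite mxE.
apply/le_anti/andP; split.
  apply: mnorm_le => [|xi]; first by rewrite mulr_ge0 ?os_norm_ge0.
  rewrite actE -mulrA ler_wpM2l//.
  rewrite -[os_norm x]ger0_norm ?os_norm_ge0// -l2normZ.
  rewrite -(@ler_pXn2r _ 2) ?nnegrE ?l2norm_ge0// !l2norm_sqr.
  apply: ler_sum => i _; rewrite ler_pXn2r ?nnegrE ?hnorm_ge0//.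
  rewrite hnormZ scalar_re_norm_of_real ger0_norm ?os_norm_ge0//.
  exact: os_normP.
have [->|ln0] := eqVneq lambda 0; first by rewrite mul0r mnorm_ge0.
have lgt0 : 0 < lambda by rewrite lt_def ln0.
rewrite -ler_pdivlMl//; apply: os_norm_le => [|h].
  by rewrite mulr_ge0 ?invr_ge0 ?mnorm_ge0.
rewrite -mulrA ler_pdivlMl//.
pose xi (i : 'I_n.+1) := if i == ord0 then h else 0.
have <- : l2norm xi = hnorm h.
  rewrite -[RHS]mul1r -l2norm1.
  apply: (@l2norm_eq _ _ _ n.+1 _ xi (fun=> h)) => //.
  rewrite big_ord1 expr1n mul1r (bigD1 ord0)//= /xi eqxx big1 ?addr0// => l lj.
  by rewrite (negbTE lj) hnorm0 expr0n.
rewrite (le_trans _ (mnormP _ _))// actE ler_wpM2l//.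
by apply: le_trans (hnorm_le_l2norm _ ord0); rewrite /xi eqxx.
Qed.

(** The constant vector with entry [h] goes to the constant vector with entry $n\,x(h)$; the factor
    $\sqrt n$ in both norms cancels. *)
Lemma mnorm_const n (x : X) : (0 < n)%N ->
  n%:R * os_norm x <= mnorm (const_mx x : 'M[X]_n).
Proof.
case: n => // n _.
rewrite -ler_pdivlMl ?ltr0n//; apply: os_norm_le => [|h].
  by rewrite mulr_ge0 ?invr_ge0 ?mnorm_ge0.
rewrite -mulrA ler_pdivlMl ?ltr0n//.
have constE (y : H) :
    l2norm (fun _ : 'I_n.+1 => y) = Num.sqrt n.+1%:R * hnorm y.
  rewrite -l2norm1.
  apply: (@l2norm_eq _ _ _ n.+1 _ (fun=> y) (fun=> y)); first exact: sqrtr_ge0.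
  by rewrite big_ord1 sqr_sqrtr ?ler0n// sumr_const card_ord mulr_natl.
have sgt0 : 0 < Num.sqrt (n.+1%:R : R) by rewrite sqrtr_gt0 ltr0n.
rewrite -(ler_pM2l sgt0) mulrCA [leRHS]mulrCA -!constE.
rewrite (le_trans _ (mnormP _ _))//.
have -> : os_act (const_mx x) (fun _ : 'I_n.+1 => h) =
   fun=> of_real k n.+1%:R *: os_val x h.
  apply/funext => i; rewrite os_actE.
  under eq_bigr do rewrite mxE.
  by rewrite sumr_const card_ord of_real_nat scaler_nat.
by rewrite l2normZ constE ger0_norm ?ler0n.
Qed.

End MatrixNorms.

(** * Coarse estimates at a fixed size *)

Lemma trmxN (V : zmodType) m n (A : 'M[V]_(m, n)) : (- A)^T = - A^T.
Proof. by apply/matrixP => i j; rewrite !mxE. Qed.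

(** Sylvester's doubling: in the block matrix with rows $(h, h)$ and $(h, -h)$ the cross terms
    cancel and the diagonal blocks add up. *)
Lemma hadamard_mx_exists (R : comNzRingType) (p : nat) :
  exists2 h : 'M[R]_(2 ^ p),
    (forall i j, h i j = 1 \/ h i j = -1) & h^T *m h = ((2 ^ p)%N%:R)%:M.
Proof.
elim: p => [|p [h h1 hh]].
  exists (const_mx 1); first by left; rewrite mxE.
  apply/matrixP => i j; rewrite !mxE !ord1 big_ord1 !mxE mulr1.
  by [].
rewrite expnS mul2n -addnn; exists (block_mx h h h (- h)).
  move=> i j; case: (split_ordP i) => i' ->; case: (split_ordP j) => j' ->;
    rewrite ?(block_mxEul, block_mxEur, block_mxEdl, block_mxEdr) //.
  by rewrite mxE; case: (h1 i' j') => ->; [right | left; rewrite opprK].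
rewrite tr_block_mx mulmx_block trmxN !(mulmxN, mulNmx) opprK subrr hh.
by rewrite -raddfD /= natrD -scalar_mx_block.
Qed.

Section CoarseEstimates.
Variables (R : realType) (k : scalar_kind) (X Y : operator_space R k).
Variables (rho omega : R -> R).

Definition coarse_at n (f : X -> Y) : Prop := forall A B : 'M[X]_n,
  rho (mnorm (A - B)) <= mnorm (map_mx f A - map_mx f B)
    <= omega (mnorm (A - B)).

(** Both matrices are padded by zeros. The added entries all become [f 0] and cancel in the
    difference, whatever the value of [f 0]. *)
Lemma coarse_at_smaller m n f : (m <= n)%N -> coarse_at n f -> coarse_at m f.
Proof.
move=> /subnKC <- cf A B; move: (n - m)%N cf => l cf.
have := cf (block_mx A 0 0 0) (block_mx B 0 0 0).
by rewrite !map_block_mx !opp_block_mx !add_block_mx !subrr !mnorm_pad.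
Qed.

Lemma coarse_at_elt n f x y : (0 < n)%N -> coarse_at n f ->
  os_norm (f x - f y) <= omega (os_norm (x - y)).
Proof.
move=> n0 /(coarse_at_smaller n0)/(_ (const_mx x) (const_mx y))/andP[_].
rewrite !map_const_mx.
have E (Z : operator_space R k) (a b : Z) :
    (const_mx a - const_mx b : 'M[Z]_1) = const_mx (a - b).
  by apply/matrixP => i j; rewrite !mxE.
by rewrite !E !mnorm1.
Qed.

(* Cutting the segment from [z] to [z + c x] into [m] pieces makes each piece
   have norm exactly [os_norm x], so no growth or monotonicity of [omega] is
   needed. *)
Lemma coarse_at_orthogonal n f (c : 'M[R]_n) m (x z : X) :
  (0 < n)%N -> (0 < m)%N -> coarse_at n f -> c^T *m c = (m%:R ^+ 2)%:M ->
  mnorm (map_mx f (const_mx z + tensor_mx c x) - const_mx (f z))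
    <= m%:R * omega (os_norm x).
Proof.
move=> n0 m0 cf cE; have m0R : m%:R != 0 :> R by rewrite pnatr_eq0 -lt0n.
pose P t := const_mx z + tensor_mx ((t%:R / m%:R) *: c) x : 'M[X]_n.
have -> : c = (m%:R / m%:R) *: c by rewrite mulfV// scale1r.
(* The induction is on the number of steps taken; the mesh $1/m$ inside [P] stays fixed. *)
rewrite -/(P m); elim: {1 2}m => [|t IH].
  rewrite mul0r (_ : _ - _ = 0) ?mnorm0//; apply/matrixP => i j.
  by rewrite /P !mxE !mul0r of_real0 scale0r addr0 subrr.
rewrite -(subrKA (map_mx f (P t))) -natr1 mulrDl mul1r [leRHS]addrC.
apply: (le_trans (mnormD _ _)); apply: lerD IH.
suff <- : mnorm (P t.+1 - P t) = os_norm x by have /andP[] := cf (P t.+1) (P t).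
have -> : P t.+1 - P t = tensor_mx (m%:R^-1 *: c) x.
  apply/matrixP => i j; rewrite /P !mxE opprD addrACA subrr add0r -scalerBl.
  rewrite -of_realN -of_realD; congr (of_real k _ *: _).
  by rewrite -mulrBl -mulrBl -natrB// subSnn div1r.
rewrite (@mnorm_tensor _ _ _ _ _ 1) ?mul1r//.
rewrite [(_ *: c)^T]linearZ /= -scalemxAl -scalemxAr cE !scale_scalar_mx.
by rewrite expr1n expr2 mulKf// mulVf.
Qed.

(** The size is a power of 4 so that its square root $2^p$ is an integer and can serve as the number
    of steps in [coarse_at_orthogonal]. *)
Lemma coarse_at_midpoint n p f (x z : X) : (2 ^ (p + p) <= n)%N ->
  coarse_at n f ->
  os_norm (f (z + x) + f (z - x) - f z *+ 2)
    <= 2 * omega (os_norm x) / (2 ^ p)%N%:R.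
Proof.
move=> pn /(coarse_at_smaller pn) {n pn}cf.
have p0 : (0 < 2 ^ p)%N by rewrite expn_gt0.
have pp0 : (0 < 2 ^ (p + p))%N by rewrite expn_gt0.
have p0R : 0 < (2 ^ p)%N%:R :> R by rewrite ltr0n.
have [h h1 hh] := hadamard_mx_exists R (p + p).
have sE : (2 ^ (p + p))%N%:R = (2 ^ p)%N%:R ^+ 2 :> R by rewrite expnD natrM.
rewrite sE in hh.
have hh' : (- h)^T *m (- h) = ((2 ^ p)%N%:R ^+ 2)%:M.
  by rewrite trmxN mulmxN mulNmx opprK.
have := lerD (coarse_at_orthogonal x z pp0 p0 cf hh)
             (coarse_at_orthogonal x z pp0 p0 cf hh').
move/(le_trans (mnormD _ _)).
set W := (W in mnorm W <= _).
(* An entry 1 or -1 of [h] only decides which of the two summands contributes $f(z+x)$ and which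
   $f(z-x)$, so every entry of [W] is the same. *)
have -> : W = const_mx (f (z + x) + f (z - x) - f z *+ 2).
  apply/matrixP => i j; rewrite !mxE addrACA -opprD -mulr2n; congr (_ - _).
  have ofN1 : of_real k (-1 : R) = -1 by rewrite of_realN of_real1.
  case: (h1 i j) => ->; rewrite ?opprK ofN1 of_real1 scaleN1r scale1r//.
  by rewrite addrC.
move/(le_trans (mnorm_const _ pp0)); rewrite sE expr2 -mulrA -mulrDr.
rewrite ler_pM2l// -mulr2n -[_ *+ 2 in leRHS]mulr_natl -ler_pdivlMl//.
by rewrite [leRHS]mulrC.
Qed.

(** The rotation with cosine [s] and sine $r = \sqrt{1 - s^2}$; the size is written [1 + 1] to match
    the block form. *)
Lemma rotation_mx_orthogonal (s : R) : -1 <= s <= 1 ->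
  exists2 c : 'M[R]_(1 + 1)%N, c^T *m c = 1%:M & c ord0 ord0 = s.
Proof.
move=> /andP[s1 s2]; pose r := Num.sqrt (1 - s ^+ 2).
have rE : r ^+ 2 = 1 - s ^+ 2 by rewrite sqr_sqrtr// subr_ge0; nra.
exists (block_mx s%:M r%:M (- r%:M) s%:M).
  rewrite tr_block_mx trmxN !tr_scalar_mx mulmx_block.
  rewrite !(mulmxN, mulNmx, opprK) -!scalar_mxM -!expr2.
  by rewrite [r * s]mulrC !subrr -!raddfD /= rE subrK subrKC -scalar_mx_block.
have -> : ord0 = lshift 1 (ord0 : 'I_1) by exact: val_inj.
by rewrite block_mxEul mxE eqxx.
Qed.

(* Completing [s] to a rotation matrix replaces [os_norm (s x)] by
   [os_norm x] in the argument of [omega]. *)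
Lemma coarse_at_scale n f (s : R) x : (1 < n)%N -> coarse_at n f ->
  -1 <= s <= 1 -> os_norm (f (of_real k s *: x) - f 0) <= omega (os_norm x).
Proof.
move=> n1 /(coarse_at_smaller n1) cf /rotation_mx_orthogonal[c cE c00].
have cE1 : c^T *m c = (1%:R ^+ 2)%:M by rewrite expr1n.
have := coarse_at_orthogonal x 0 (isT : 0 < 2)%N (isT : 0 < 1)%N cf cE1.
rewrite mul1r; apply: le_trans.
have := mnorm_entry (map_mx f (const_mx 0 + tensor_mx c x) - const_mx (f 0))
  ord0 ord0.
by rewrite !mxE c00 add0r.
Qed.

End CoarseEstimates.

(** * Norms on the ultrapower *)

Lemma ultrafilter_fmap (T S : Type) (f : T -> S) (F : set_system T) :
  UltraFilter F -> UltraFilter (f @ F).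
Proof.
move=> FU; split=> [|G GF FG]; first exact: fmap_proper_filter.
apply/seteqP; split=> // A GA.
have [//|FnA] := in_ultra_setVsetC (f @^-1` A) FU.
have GnA : G (~` A) by apply: FG.
by have [x []] := filter_ex (filterI GA GnA).
Qed.

Lemma cvg_sumr (R : realType) (T I : Type) (F : set_system T) (r : seq I)
    (f : I -> T -> R) (l : I -> R) : Filter F ->
  (forall i, f i @ F --> l i) ->
  (\sum_(i <- r) f i x) @[x --> F] --> \sum_(i <- r) l i.
Proof.
move=> FF fl; elim: r => [|i r IH].
  by rewrite big_nil; under eq_fun do rewrite big_nil; exact: cvg_cst.
by rewrite big_cons; under eq_fun do rewrite big_cons; apply: cvgD.
Qed.

(** The image of [U] is an ultrafilter containing the compact segment $[-M, M]$, hence converges. *)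
Lemma ultrafilter_bounded_cvg (R : realType) (U : ultrafilter_on nat)
    (a : nat -> R) (M : R) :
  (forall m, `|a m| <= M) -> cvg (a m @[m --> ultrafilter U]).
Proof.
move=> aM.
have aU : UltraFilter (a m @[m --> ultrafilter U]) by exact: ultrafilter_fmap.
have := @segment_compact R (- M) M; rewrite compact_ultra.
move=> /(_ _ aU)[|x [_ ax]]; last by apply/cvg_ex; exists x.
have sub m : `[- M, M]%classic (a m) by rewrite /= in_itv /= -ler_norml.
exact: (filterS (fun m _ => sub m) (@filterT _ (ultrafilter U) _)).
Qed.

(** Each induction step discards one point [N]: if its complement were not in [U], the singleton
    would be, and [U] would be principal at [N]. *)
Lemma nonprincipal_ge (U : ultrafilter_on nat) (N : nat) :
  nonprincipal U -> \forall m \near ultrafilter U, (N <= m)%N.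
Proof.
move=> npU; elim: N => [|N IH]; first exact: nearW.
suff UN : ultrafilter U [set m | m != N].
  by apply: filterS2 IH UN => m /= Nm mN; rewrite ltn_neqAle eq_sym mN.
have [//|] := in_ultra_setVsetC [set m | m != N] (ultrafilter_class U).
move=> UN; case: (npU N); apply/seteqP; split=> A; last first.
  move=> /principal_filterP AN; apply: filterS UN => m /= /negP.
  by rewrite negbK => /eqP ->.
move=> UA; apply/principal_filterP.
have [m [/= Am /negP]] := filter_ex (filterI UA UN).
by rewrite negbK => /eqP <-.
Qed.

Section UltrapowerNorm.
Variables (R : realType) (k : scalar_kind) (Y : operator_space R k).
Variable U : ultrafilter_on nat.
Local Notation Z := (ultrapower Y U).
Local Notation bseq := (bounded_seq Y).

Local Notation quot := (Quotient.quot (null_seq_pred (Y := Y) U)).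

Definition upi (y : bseq) : Z := \pi_(ultrapower_sort Y U) y.

Lemma upiD y z : upi (y + z) = upi y + upi z.
Proof. exact: (@pi_addr _ _ _ _ _ quot). Qed.

Lemma upiN y : upi (- y) = - upi y.
Proof. exact: (@pi_oppr _ _ _ _ _ quot). Qed.

Lemma upi0 : upi 0 = 0.
Proof. by rewrite -[0 in LHS](subrr (0 : bseq)) upiD upiN subrr. Qed.

Lemma upiZ a y : upi (a *: y) = a *: upi y.
Proof. exact: pi_scale. Qed.

Lemma upi_surj (v : Z) : exists y, v = upi y.
Proof. by exists (repr (v : ultrapower_sort Y U)); rewrite /upi reprK. Qed.

Lemma upi_eqP y z : upi y = upi z <->
  os_norm (y m - z m) @[m --> ultrafilter U] --> (0 : R).
Proof.
split=> [/eqP|yz]; last apply/eqP; rewrite -Quotient.idealrBE inE//.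
Qed.

Definition mx_at n (A : 'M[bseq]_n) (m : nat) : 'M[Y]_n :=
  \matrix_(i, j) A i j m.

Lemma mnorm_bounded_seq n (A : 'M[bseq]_n) :
  exists M, forall m, mnorm (mx_at A m) <= M.
Proof.
have /choice[B AB] : forall ij : 'I_n * 'I_n,
    exists M : R, forall m, os_norm (A ij.1 ij.2 m) <= M.
  by move=> ij; have := bseq_valP (A ij.1 ij.2); rewrite inE.
exists (\sum_i \sum_j B (i, j)) => m; rewrite (le_trans (mnorm_le_sum _))//.
by apply: ler_sum => i _; apply: ler_sum => j _; rewrite mxE (AB (i, j)).
Qed.

Lemma is_cvg_mnorm n (A : 'M[bseq]_n) :
  cvg (mnorm (mx_at A m) @[m --> ultrafilter U]).
Proof.
have [M AM] := mnorm_bounded_seq A.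
by apply: (@ultrafilter_bounded_cvg _ _ _ M) => m; rewrite ger0_norm ?mnorm_ge0.
Qed.

Arguments is_cvg_mnorm {n} A.

(** Independence of the representatives: those picked by [repr] differ from [A] by null sequences in
    each entry, and the sum [d] of the norms of these differences controls the change of the matrix
    norm. *)
Lemma cvg_ultrapower_mnorm n (A : 'M[bseq]_n) :
  mnorm (mx_at A m) @[m --> ultrafilter U] -->
  mnorm (map_mx upi A : 'M[Z]_n).
Proof.
pose B : 'M[bseq]_n :=
  \matrix_(i, j) repr (map_mx upi A i j : ultrapower_sort Y U).
have cvB : mnorm (mx_at B m) @[m --> ultrafilter U] -->
    mnorm (map_mx upi A : 'M[Z]_n).
  have := is_cvg_mnorm B.
  suff -> : mx_at B = fun m => \matrix_(i, j)
    (repr (map_mx upi A i j : ultrapower_sort Y U) : bseq) m by [].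
  by apply/funext => m; apply/matrixP => i j; rewrite !mxE.
pose d m := \sum_i \sum_j os_norm (A i j m - B i j m).
have cvd : d m @[m --> ultrafilter U] --> (0 : R).
  have -> : 0 = \sum_(i < n) \sum_(j < n) (0 : R).
    by rewrite big1// => i _; rewrite big1.
  apply: (cvg_sumr (f := fun i m => \sum_j os_norm (A i j m - B i j m))) => i.
  apply: (cvg_sumr (f := fun j m => os_norm (A i j m - B i j m))) => j.
  by apply/upi_eqP; rewrite !mxE /upi reprK.
have le_d m : mnorm (mx_at A m - mx_at B m) <= d m.
  rewrite (le_trans (mnorm_le_sum _))//.
  by apply: ler_sum => i _; apply: ler_sum => j _; rewrite !mxE.
have cvl : mnorm (mx_at B m) - d m @[m --> ultrafilter U] -->
    mnorm (map_mx upi A : 'M[Z]_n).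
  by rewrite -[X in _ --> X]subr0; exact: cvgB.
have cvr : mnorm (mx_at B m) + d m @[m --> ultrafilter U] -->
    mnorm (map_mx upi A : 'M[Z]_n).
  by rewrite -[X in _ --> X]addr0; exact: cvgD.
apply: squeeze_cvgr cvl cvr; apply: nearW => m; apply/andP; split.
  rewrite lerBlDr -[mx_at B m](subrK (mx_at A m)) addrC.
  by rewrite (le_trans (mnormD _ _))// lerD2l -mnormN opprB.
rewrite -[mx_at A m](subrK (mx_at B m)) addrC.
by rewrite (le_trans (mnormD _ _))// lerD2l.
Qed.

Arguments cvg_ultrapower_mnorm {n} A.

Lemma upi_mx_surj n (A : 'M[Z]_n) : exists B : 'M[bseq]_n, A = map_mx upi B.
Proof.
exists (map_mx (fun v : Z => repr (v : ultrapower_sort Y U)) A).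
by apply/matrixP => i j; rewrite !mxE /upi reprK.
Qed.

Lemma ultrapower_mnorm_ge0 n (A : 'M[Z]_n) : 0 <= mnorm A.
Proof.
have [B ->] := upi_mx_surj A; apply: cvgr_to_ge (cvg_ultrapower_mnorm B) _.
by apply: nearW => m; exact: mnorm_ge0.
Qed.

Lemma mx_atD n (A B : 'M[bseq]_n) m : mx_at (A + B) m = mx_at A m + mx_at B m.
Proof. by apply/matrixP => i j; rewrite !mxE. Qed.

Lemma ultrapower_mnormD n (A B : 'M[Z]_n) : mnorm (A + B) <= mnorm A + mnorm B.
Proof.
have [A' ->] := upi_mx_surj A; have [B' ->] := upi_mx_surj B.
have -> : map_mx upi A' + map_mx upi B' = map_mx upi (A' + B').
  by apply/matrixP => i j; rewrite !mxE upiD.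
apply: ler_cvg_to (cvg_ultrapower_mnorm (A' + B'))
  (cvgD (cvg_ultrapower_mnorm A') (cvg_ultrapower_mnorm B')) _.
by apply: nearW => m; rewrite mx_atD; exact: mnormD.
Qed.

Lemma ultrapower_mnormZ n (c : R) (A : 'M[Z]_n) :
  mnorm (rscale_mx c A) = `|c| * mnorm A.
Proof.
have [B ->] := upi_mx_surj A.
have -> : rscale_mx c (map_mx upi B) = map_mx upi (rscale_mx c B).
  by apply/matrixP => i j; rewrite !mxE upiZ.
apply: (cvg_unique _ (cvg_ultrapower_mnorm (rscale_mx c B))).
  exact: norm_hausdorff.
have cB m : mnorm (mx_at (rscale_mx c B) m) = `|c| * mnorm (mx_at B m).
  rewrite -mnormZ; congr mnorm.
  by apply/matrixP => i j; rewrite !mxE.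
rewrite /= (eq_cvg _ _ cB).
by apply: cvgM; [exact: cvg_cst | exact: cvg_ultrapower_mnorm].
Qed.

Definition unorm (v : Z) : R := mnorm (const_mx v : 'M[Z]_1).

Lemma unorm_ge0 v : 0 <= unorm v.
Proof. exact: ultrapower_mnorm_ge0. Qed.

Lemma unormD v w : unorm (v + w) <= unorm v + unorm w.
Proof.
have := ultrapower_mnormD (const_mx v : 'M[Z]_1) (const_mx w).
rewrite /unorm (_ : const_mx v + const_mx w = const_mx (v + w))//.
by apply/matrixP => i j; rewrite !mxE.
Qed.

Lemma unormZ (c : R) v : unorm (of_real k c *: v) = `|c| * unorm v.
Proof.
rewrite /unorm -ultrapower_mnormZ; congr mnorm.
by apply/matrixP => i j; rewrite !mxE.
Qed.

Lemma unormMn v n : unorm (v *+ n) = n%:R * unorm v.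
Proof.
by rewrite -scaler_nat -of_real_nat unormZ ger0_norm ?ler0n.
Qed.

Lemma cvg_unorm (y : bseq) :
  os_norm (y m) @[m --> ultrafilter U] --> unorm (upi y).
Proof.
have := cvg_ultrapower_mnorm (const_mx y : 'M[bseq]_1); rewrite map_const_mx.
have yE m : mnorm (mx_at (const_mx y : 'M[bseq]_1) m) = os_norm (y m).
  by rewrite -mnorm1; congr mnorm; apply/matrixP => i j; rewrite !mxE.
by rewrite (eq_cvg _ _ yE).
Qed.

Lemma unorm_eq0 v : unorm v = 0 -> v = 0.
Proof.
have [y ->] := upi_surj v => y0.
rewrite -upi0; apply/upi_eqP; rewrite -[X in _ --> X]y0.
have yE m : os_norm (y m - (0 : bseq) m) = os_norm (y m) by rewrite subr0.
by rewrite (eq_cvg _ _ yE); exact: cvg_unorm.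
Qed.

(** Additivity makes [G] vanish on the integers, so subtracting the integer part extends the bound
    [K] to the whole line. Then $n\,|G(s)| = |G(ns)| \le K$ for all [n] forces $G(s) = 0$. This is
    what turns additivity of the limit map into real homogeneity. *)
Lemma bounded_additive_eq0 (G : R -> Z) (K : R) :
  {morph G : s t / s + t} -> G 1 = 0 ->
  (forall s, 0 <= s <= 1 -> unorm (G s) <= K) -> forall s, G s = 0.
Proof.
move=> GD G1 GK.
have G0 : G 0 = 0 by apply: (addIr (G 0)); rewrite -GD !add0r.
have GN s : G (- s) = - G s.
  by apply: (addIr (G s)); rewrite -GD !addNr.
have GMn s n : G (s *+ n) = G s *+ n.
  by elim: n => [|n IH]; rewrite ?mulr0n// !mulrS GD IH.
have Gint (z : int) : G z%:~R = 0.
  by case: z => n; rewrite ?NegzE ?mulrNz ?GN GMn G1 mul0rn ?oppr0.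
have bG s : unorm (G s) <= K.
  rewrite -(subrKC (Num.floor s)%:~R s) GD Gint add0r; apply: GK.
  rewrite subr_ge0 floor_le lerBlDl.
  by rewrite -[1]/(1%:~R) -intrD ltW// floorD1_gt.
move=> s; apply: unorm_eq0; apply/le_anti; rewrite unorm_ge0 andbT leNgt.
apply/negP => e0; pose n := (Num.truncn (K / unorm (G s))).+1.
have := bG (s *+ n); rewrite GMn unormMn leNgt -ltr_pdivrMr//.
by rewrite truncnS_gt.
Qed.

End UltrapowerNorm.

Arguments cvg_ultrapower_mnorm {R k Y} U {n} A.
Arguments cvg_unorm {R k Y} U y.

(** * The limit map *)

Section LimitMap.
Variables (R : realType) (k : scalar_kind) (X Y : operator_space R k).
Variables (rho omega : R -> R) (f : nat -> X -> Y).
Hypothesis coarse_f : forall n, (0 < n)%N -> coarse_at rho omega n (f n).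
Variable U : ultrafilter_on nat.
Hypothesis npU : nonprincipal U.
Local Notation Z := (ultrapower Y U).

(** The index is shifted by one because the estimates begin at size 1; subtracting the value at 0
    lets [omega] bound each term. *)
Lemma limit_seq_bounded x :
  (fun m => f m.+1 x - f m.+1 0) \in bounded_seq_pred (Y := Y).
Proof.
rewrite inE; exists (omega (os_norm x)) => m.
rewrite -[x in leRHS]subr0.
exact: (coarse_at_elt _ _ (ltn0Sn m) (coarse_f _)).
Qed.

Definition limit_seq x : bounded_seq Y := BoundedSeq (limit_seq_bounded x).

Definition limit_map x : Z := upi U (limit_seq x).

(** For almost every [m] the size [m.+1] is at least [n], so the coarse estimate between [A] and the
    zero matrix holds at size [n]. Its outer terms do not depend on [m] and survive the limit. *)
Lemma limit_map_bounds n (A : 'M[X]_n) :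
  rho (mnorm A) <= mnorm (map_mx limit_map A) <= omega (mnorm A).
Proof.
have -> : map_mx limit_map A = map_mx (upi U) (map_mx limit_seq A).
  by rewrite -map_mx_comp.
have bA : \forall m \near ultrafilter U,
    rho (mnorm A) <= mnorm (mx_at (map_mx limit_seq A) m) <= omega (mnorm A).
  near=> m.
  have nm : (n <= m.+1)%N by rewrite leqW//; near: m; exact: nonprincipal_ge.
  have := coarse_at_smaller nm (coarse_f (ltn0Sn m)) A 0.
  suff -> : mx_at (map_mx limit_seq A) m =
      map_mx (f m.+1) A - map_mx (f m.+1) 0 by rewrite subr0.
  by apply/matrixP => i j; rewrite !mxE.
apply/andP; split.
  apply: cvgr_to_ge (cvg_ultrapower_mnorm U (map_mx limit_seq A)) _.
  by apply: filterS bA => m /andP[].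
apply: cvgr_to_le (cvg_ultrapower_mnorm U (map_mx limit_seq A)) _.
by apply: filterS bA => m /andP[].
Unshelve. all: by end_near. Qed.

Lemma limit_map0 : limit_map 0 = 0.
Proof.
rewrite -(upi0 Y U) /limit_map; congr upi; apply: val_inj; apply/funext => m /=.
exact: subrr.
Qed.

Lemma limit_map_midpoint z x :
  limit_map (z + x) + limit_map (z - x) = limit_map z *+ 2.
Proof.
rewrite mulr2n -!upiD; apply/upi_eqP/cvgrPdist_le => e e0.
(* This choice gives $2\omega(|x|)/e < p < 2^p$, so the midpoint error $2\omega(|x|)/2^p$ is at most
   [e] once $4^p \le m+1$. *)
pose p := (Num.truncn (2 * omega (os_norm x) / e)).+1.
near=> m.
rewrite sub0r normrN ger0_norm ?os_norm_ge0//=.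
set w := (w in os_norm w).
(* The base values [f m.+1 0] occur twice with each sign and cancel. *)
have -> : w = f m.+1 (z + x) + f m.+1 (z - x) - f m.+1 z *+ 2.
  rewrite /w /= mulr2n !opprD !opprK.
  have cancel0 (a b c : Y) : a - c + (- b + c) = a - b.
    by rewrite [- b + c]addrC addrA subrK.
  by rewrite addrACA [RHS]addrACA !cancel0.
have pm : (2 ^ (p + p) <= m.+1)%N.
  by rewrite leqW//; near: m; exact: nonprincipal_ge.
rewrite (le_trans (coarse_at_midpoint x z pm (coarse_f (ltn0Sn m))))//.
rewrite ler_pdivrMr ?ltr0n ?expn_gt0// -ler_pdivrMl// mulrC.
rewrite (le_trans (ltW (truncnS_gt _)))// ler_nat.
by rewrite ltnW// ltn_expl.
Unshelve. all: by end_near. Qed.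

(** The midpoint identity at centre $(x+y)/2$ with increment $(x-y)/2$ gives $F(x) + F(y) =
    2F((x+y)/2)$. Since $F(0) = 0$, the case of equal centre and increment shows that [F] commutes
    with doubling. *)
Lemma limit_mapD : {morph limit_map : x y / x + y}.
Proof.
move=> x y.
pose h : Defs.scalar R k := 2^-1.
have half (v : X) : h *: (v *+ 2) = v.
  by rewrite -[v *+ 2]scaler_nat scalerA mulVf ?scale1r ?pnatr_eq0.
have dbl v : limit_map (v *+ 2) = limit_map v *+ 2.
  by have := limit_map_midpoint v v; rewrite subrr limit_map0 addr0 mulr2n.
have := limit_map_midpoint (h *: (x + y)) (h *: (x - y)).
rewrite -dbl scalerMnr -scalerDr -scalerBr half => <-.
have -> : x + y + (x - y) = x *+ 2 by rewrite addrACA subrr addr0 mulr2n.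
have -> : x + y - (x - y) = y *+ 2.
  by rewrite opprD opprK addrACA subrr add0r mulr2n.
by rewrite !half.
Qed.

Lemma limit_mapZ (a : R) x :
  limit_map (of_real k a *: x) = of_real k a *: limit_map x.
Proof.
(* [G] measures the failure of homogeneity: it is additive, vanishes at 1, and is bounded on
   $[0, 1]$ by the rotation estimate, which requires size at least 2. *)
pose G s := limit_map (of_real k s *: x) - of_real k s *: limit_map x.
suff : G a = 0 by move/eqP; rewrite subr_eq0 => /eqP.
apply: (bounded_additive_eq0 (G := G)
  (K := omega (os_norm x) + unorm (limit_map x))).
- by move=> s t; rewrite /G of_realD !scalerDl limit_mapD opprD addrACA.
- by rewrite /G of_real1 !scale1r subrr.
move=> s /andP[s0 s1]; rewrite (le_trans (unormD _ _))// lerD//; last first.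
  rewrite -scaleNr -of_realN unormZ normrN ger0_norm//.
  by rewrite ler_piMl// unorm_ge0.
apply: cvgr_to_le (cvg_unorm U (limit_seq (of_real k s *: x))) _.
near=> m; have m1 : (1 < m.+1)%N.
  by rewrite ltnS; near: m; exact: nonprincipal_ge.
apply: (coarse_at_scale x m1 (coarse_f (ltn0Sn m))).
by rewrite s1 (le_trans _ s0)// lerN10.
Unshelve. all: by end_near. Qed.

Lemma limit_map_rscale n (a : R) (A : 'M[X]_n) :
  map_mx limit_map (rscale_mx a A) = rscale_mx a (map_mx limit_map A).
Proof. by apply/matrixP => i j; rewrite !mxE limit_mapZ. Qed.

(** Scaling [A] to norm 1 turns the coarse bound into a linear one; the zero matrix, which cannot be
    scaled so, is treated first. *)
Lemma limit_map_upper n (A : 'M[X]_n) :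
  mnorm (map_mx limit_map A) <= omega 1 * mnorm A.
Proof.
have [A0|A0] := eqVneq (mnorm A) 0.
  have -> : map_mx limit_map A = rscale_mx 0 (0 : 'M[Z]_n).
    rewrite (mnorm_eq0 A0); apply/matrixP => i j.
    by rewrite !mxE limit_map0 scaler0.
  by rewrite ultrapower_mnormZ A0 normr0 mul0r mulr0.
have Agt0 : 0 < mnorm A by rewrite lt_def A0 mnorm_ge0.
have /andP[_] := limit_map_bounds (rscale_mx (mnorm A)^-1 A).
rewrite limit_map_rscale ultrapower_mnormZ mnormZ normfV (gtr0_norm Agt0).
by rewrite mulVf// ler_pdivrMl// mulrC.
Qed.

(** Scaling [A] to norm [t0], where [rho] is at least 1, makes the norm of the scaled image at least
    1. *)
Lemma limit_map_lower (t0 : R) n (A : 'M[X]_n) : 0 < t0 -> 1 <= rho t0 ->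
  mnorm A <= t0 * mnorm (map_mx limit_map A).
Proof.
move=> t0gt0 rho1; have [->|A0] := eqVneq (mnorm A) 0.
  by rewrite mulr_ge0 ?ultrapower_mnorm_ge0// ltW.
have Agt0 : 0 < mnorm A by rewrite lt_def A0 mnorm_ge0.
have /andP[+ _] := limit_map_bounds (rscale_mx (t0 / mnorm A) A).
have c0 : 0 < t0 / mnorm A by rewrite divr_gt0.
rewrite limit_map_rscale ultrapower_mnormZ mnormZ (gtr0_norm c0).
rewrite divfK// => /(le_trans rho1).
by rewrite mulrAC ler_pdivlMr// mul1r.
Qed.

Lemma limit_map_inj (t0 : R) : 0 < t0 -> 1 <= rho t0 -> injective limit_map.
Proof.
move=> t0gt0 rho1 x y xy; apply/eqP; rewrite -subr_eq0; apply/eqP.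
have NE v : limit_map (- v) = - limit_map v.
  by apply: (addIr (limit_map v)); rewrite -limit_mapD !addNr limit_map0.
apply: os_norm_eq0; apply/le_anti; rewrite os_norm_ge0 andbT -mnorm1.
rewrite (le_trans (limit_map_lower _ t0gt0 rho1))//.
rewrite map_const_mx limit_mapD NE xy subrr.
by rewrite -(scaler0 _ (of_real k 0)) [mnorm _]unormZ normr0 mul0r mulr0.
Qed.

End LimitMap.

Theorem proposition4p4 (R : realType) (k : scalar_kind)
    (X Y : operator_space R k) :
  almost_completely_coarsely_embeds X Y ->
  forall U : ultrafilter_on nat, nonprincipal U ->
    completely_real_isomorphically_embeds X (ultrapower Y U).
Proof.
move=> [rho [omega [_ _ /cvgryPge rho_oo [f coarse_f]]]] U npU.
have [t0 t0gt0 rho1] := pinfty_ex_gt0 (rho_oo 1).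
pose u := limit_map coarse_f U.
have u_inj : injective u := limit_map_inj npU t0gt0 rho1.
(* The left inverse is determined on the range of [u] and takes the default value 0 elsewhere. *)
have /choice[v vP] : forall z, exists x : X, range u z -> u x = z.
  move=> z; have [[x _ xz]|nz] := pselect (range u z); first by exists x.
  by exists 0.
have uK : cancel u v by move=> x; apply: u_inj; apply: vP; exists x.
exists u; split=> //.
- by move=> a x y; rewrite /u limit_mapD// limit_mapZ.
- by exists (omega 1) => n _ A _; exact: limit_map_upper.
exists v => //; exists t0 => n _ A uA.
(* All entries of [A] lie in the range, so the bound for [v] at [A] is the lower bound for [u] at
   [map_mx v A]. *)
have {2}-> : A = map_mx u (map_mx v A).
  by apply/matrixP => i j; rewrite !mxE vP.
exact: limit_map_lower.
Qed.
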